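(* Let $M\in R^{n,m}$ be a matrix with $m\ge n$ and $\operatorname{rank} M=n-1$. Let $C(M)\subseteq R^n$ be the $R$-module generated by the columns of $M$. Then $M$ is a presentation matrix if and only if every syzygy on $\gamma(M)$ belongs to $C(M)$.
   Context: $k$ is a field and $R=k[x_1,\ldots,x_r]$, $r\ge 3$. $R^{n,m}$ denotes the $n\times m$ matrices over $R$. A matrix $M\in R^{n,m}$ with $m\ge n$ is called a presentation matrix if it is the matrix of a map $\varphi$ in an exact sequence $R^m\xrightarrow{\varphi}R^n\to R$ (exact at $R^n$); such an $M$ necessarily has rank $n-1$. For $N\in R^{n,n-1}$ put $g_i(N)=(-1)^{i+1}N_i$, where $N_i$ is the minor of $N$ obtained by deleting the $i$-th row. For $M\in R^{n,m}$ with $n\le m$ and $\operatorname{rank} M=n-1$, choose $n-1$ columns of $M$ forming a submatrix $N$ of rank $n-1$, let $d_N=\gcd(g_1(N),\ldots,g_n(N))$, and set $\gamma(M)=(g_1(N)/d_N,\ldots,g_n(N)/d_N)$. This vector is independent of the choice of $N$ up to multiplication by a unit. A syzygy on $(g_1,\ldots,g_n)$ is a vector $(v_1,\ldots,v_n)\in R^n$ with $\sum_i v_ig_i=0$. *)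

(* Defs.v *)
From mathcomp Require Export all_boot all_order all_algebra.
From mathcomp Require Export fraction mpoly.

Set Implicit Arguments.
Unset Strict Implicit.
Unset Printing Implicit Defensive.

Import GRing.Theory.
Local Open Scope ring_scope.

(* Rank of a matrix over a domain: its rank over the field of fractions. *)
Definition rank_dom (R : idomainType) (n m : nat) (M : 'M[R]_(n, m)) : nat :=
  \rank (map_mx (@tofrac R) M).

Definition in_colspan (R : idomainType) (n m : nat) (M : 'M[R]_(n, m))
    (v : 'cV[R]_n) : Prop :=
  exists c : 'I_m -> R, v = \sum_j c j *: col j M.

(* R^o is R seen as a module over itself; the zero map is not excluded here,
   but it cannot occur when the rank of M is less than n. *)
Definition presentation_matrix (R : idomainType) (n m : nat)
    (M : 'M[R]_(n, m)) : Prop :=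
  (n <= m)%N /\
  exists psi : {linear 'cV[R]_n -> R^o},
    forall v : 'cV[R]_n, psi v = 0 <-> exists u : 'cV[R]_m, v = M *m u.

(* Indices start at 0, so the sign (-1)^(i+1) of the 1-based convention
   becomes (-1)^i. *)
Definition signed_minor (R : idomainType) (n : nat) (N : 'M[R]_(n, n.-1))
    (i : 'I_n) : R :=
  (-1) ^+ i * \det (row' i N).

Definition dvd_dom (R : idomainType) (d a : R) : Prop := exists q, a = q * d.

(* A gcd is determined only up to a unit, hence a predicate. *)
Definition is_gcd (R : idomainType) (n : nat) (g : 'I_n -> R) (d : R) : Prop :=
  (forall i, dvd_dom d (g i)) /\
  (forall e, (forall i, dvd_dom e (g i)) -> dvd_dom e d).

(* The vectors gamma(M) arising from all admissible choices of the submatrix N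
   (the columns f(0) < ... < f(n-2) of M) and of the gcd d of its minors; they
   differ by units.  Since N has rank n-1 and 0 < n, some minor is nonzero, so d
   is nonzero and the last equation says that g i 0 is the minor divided
   by d. *)
Definition is_gamma (R : idomainType) (n m : nat) (M : 'M[R]_(n, m))
    (g : 'cV[R]_n) : Prop :=
  exists (f : 'I_n.-1 -> 'I_m) (d : R),
    [/\ {homo f : i j / (i < j)%N},
        rank_dom (colsub f M) = n.-1,
        is_gcd (signed_minor (colsub f M)) d
      & forall i, signed_minor (colsub f M) i = g i 0 * d].

Definition syzygy (R : idomainType) (n : nat) (g v : 'cV[R]_n) : Prop :=
  \sum_i v i 0 * g i 0 = 0.

(* Main.v *)
From HB Require Import structures.
Require Import Defs.
Set Implicit Arguments.
Unset Strict Implicit.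
Unset Printing Implicit Defensive.
Import GRing.Theory.
Local Open Scope ring_scope.

(** Let [g] be the vector of signed maximal minors of [n - 1] independent
    columns [N] of [M], divided by a common factor.  Two facts about [g] carry
    the proof.

    First, [g] is orthogonal to every column [c] of [M]: up to the common
    factor, the product of [c] and [g] is the Laplace expansion of the
    determinant of the square matrix whose columns are [c] and those of [N], and
    this determinant vanishes because [M] has rank [n - 1]
    ([sum_col_signed_minor], [gamma_mulmx]).

    Second, [g] is nonzero ([signed_minor_neq0]), so over the fraction field it
    spans the left kernel of [M], which is a line.  Hence a linear form that
    kills the columns of [M] is proportional to the form [v |-> \sum_i v_i g_i],
    and vanishes on every syzygy on [g] ([left_kernel_common_zeros]).

    If [M] presents the image of a form [psi], then [psi] kills the columns of
    [M], hence all syzygies on [g], and by exactness these lie in the column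
    space.  Conversely, if all syzygies on [g] are combinations of columns of
    [M], the form defined by [g] itself has the column space as its kernel. *)

(** The maximal minors of a matrix of full column rank over a field cannot all
    vanish: some [n] rows already have rank [n], and they avoid one of the
    [n.+1] indices. *)
Lemma row'_det_neq0 (F : fieldType) (n : nat) (N : 'M[F]_(n.+1, n)) :
  \rank N = n -> exists i, \det (row' i N) != 0.
Proof.
move=> rN.
have fN : row_full N by rewrite /row_full rN.
set h := fullrankfun fN.
have [i hi] : exists i, i \notin codom h.
  apply/existsP; apply: contraT; rewrite negb_exists => /forallP hall.
  have : (#|'I_n.+1| <= #|codom h|)%N.
    by apply/subset_leq_card/subsetP => i _; have := hall i; rewrite negbK.
  by move=> /leq_trans/(_ (leq_image_card _ _)); rewrite !card_ord ltnn.
exists i; rewrite -unitfE -[_ \is a _]/(_ \in unitmx) -row_full_unit -sub1mx.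
have : row_full (rowsub h N) by apply: fullrowsub_full.
rewrite -sub1mx => /submx_trans; apply.
apply/row_subP => j.
have /unlift_some [l hl _] : i != h j.
  by apply: contraNneq hi => ->; apply: codom_f.
have -> : row j (rowsub h N) = row l (row' i N).
  by apply/rowP => c; rewrite !mxE hl.
exact: row_sub.
Qed.

Lemma signed_minor_neq0 (R : idomainType) (n : nat) (N : 'M[R]_(n.+1, n)) :
  rank_dom N = n -> exists i, signed_minor N i != 0.
Proof.
move=> /row'_det_neq0 [i]; rewrite -map_row' det_map_mx tofrac_eq0 => di.
by exists i; rewrite /signed_minor mulf_neq0 // signr_eq0.
Qed.

(** The sum is the Laplace expansion, along its first column, of the determinant
    formed by column [j] and the columns selected by [f].  That determinant has
    more columns than the rank of [M], even when [j] is a value of [f]. *)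
Lemma sum_col_signed_minor (R : idomainType) (n m : nat)
    (M : 'M[R]_(n.+1, m)) (f : 'I_n -> 'I_m) (j : 'I_m) :
  (rank_dom M <= n)%N ->
  \sum_i M i j * signed_minor (colsub f M) i = 0.
Proof.
move=> rM.
pose B := colsub (fun l => oapp f j (unlift 0 l)) M.
have -> : \sum_i M i j * signed_minor (colsub f M) i = \det B.
  rewrite (expand_det_col B 0); apply: eq_bigr => i _.
  rewrite mxE unlift_none /cofactor /signed_minor addn0.
  by congr (_ * (_ * \det _)); apply/matrixP => a b; rewrite !mxE liftK.
apply/eqP; rewrite -tofrac_eq0 -det_map_mx -[_ == 0]negbK -unitfE.
rewrite -[_ \is a _]/(_ \in unitmx) -row_free_unit -row_leq_rank -ltnNge ltnS.
apply: leq_trans rM; rewrite /rank_dom.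
have -> : map_mx (@tofrac R) B =
    map_mx (@tofrac R) M *m
      colsub (fun l => oapp f j (unlift 0 l)) 1%:M.
  by rewrite mulmx_colsub mulmx1 map_mxsub.
exact: mxrankM_maxl.
Qed.

(** Over the fraction field the left kernel of [M] is a line, so the nonzero
    vector [g] spans it and [p] is a multiple of [g] there; the resulting equation descends
    because [R] embeds in its fraction field. *)
Lemma left_kernel_common_zeros (R : idomainType) (n m : nat)
    (M : 'M[R]_(n.+1, m)) (p g : 'rV[R]_n.+1) (v : 'cV[R]_n.+1) :
  rank_dom M = n -> p *m M = 0 -> g *m M = 0 -> g != 0 -> g *m v = 0 ->
  p *m v = 0.
Proof.
rewrite /rank_dom => rM pM gM g0 gv.
have kerP (u : 'rV[R]_n.+1) : u *m M = 0 ->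
    (map_mx (@tofrac R) u <= kermx (map_mx (@tofrac R) M))%MS.
  by move=> uM; apply/sub_kermxP; rewrite -map_mxM uM map_mx0.
have frac_inj a b : injective (@map_mx _ _ (@tofrac R) a b).
  move=> A B /matrixP AB; apply/matrixP => i j.
  by apply/eqP; rewrite -tofrac_eq; have := AB i j; rewrite !mxE => ->.
have gker : (kermx (map_mx (@tofrac R) M) <= map_mx (@tofrac R) g)%MS.
  rewrite -(geq_leqif (mxrank_leqif_sup (kerP _ gM))) mxrank_ker rM subSnn.
  by rewrite lt0n mxrank_eq0 -(map_mx0 (@tofrac R)) (inj_eq (@frac_inj _ _)).
have /sub_rVP [a pa] := submx_trans (kerP _ pM) gker.
apply: frac_inj; rewrite map_mxM pa -scalemxAl -map_mxM gv.
by rewrite !map_mx0 scaler0.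
Qed.

Lemma syzygyE (R : idomainType) (n : nat) (g v : 'cV[R]_n) :
  syzygy g v <-> g^T *m v = 0.
Proof.
have E : (g^T *m v) 0 0 = \sum_i v i 0 * g i 0.
  by rewrite mxE; apply: eq_bigr => i _; rewrite mxE mulrC.
rewrite /syzygy -E; split=> [s|->]; last by rewrite mxE.
by apply/matrixP => i j; rewrite !ord1 s mxE.
Qed.

Lemma in_colspanE (R : idomainType) (n m : nat) (M : 'M[R]_(n, m))
    (v : 'cV[R]_n) :
  in_colspan M v <-> exists u : 'cV[R]_m, v = M *m u.
Proof.
have E (u : 'cV[R]_m) : M *m u = \sum_j u j 0 *: col j M.
  apply/colP => i; rewrite mxE summxE.
  by apply: eq_bigr => j _; rewrite !mxE mulrC.
split=> [[c ->]|[u ->]]; last by exists (fun j => u j 0).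
exists (\col_j c j); rewrite E.
by apply: eq_bigr => j _; rewrite mxE.
Qed.

Lemma gamma_neq0 (R : idomainType) (n m : nat) (M : 'M[R]_(n.+1, m))
    (g : 'cV[R]_n.+1) :
  is_gamma M g -> g != 0.
Proof.
case=> f [d [_ /signed_minor_neq0 [i mi] _ eg]].
by apply: contraNneq mi => g0; rewrite eg g0 mxE mul0r.
Qed.

Lemma gamma_mulmx (R : idomainType) (n m : nat) (M : 'M[R]_(n.+1, m))
    (g : 'cV[R]_n.+1) :
  (rank_dom M <= n)%N -> is_gamma M g -> g^T *m M = 0.
Proof.
move=> rM [f [d [_ /signed_minor_neq0 [i mi] _ eg]]].
have d0 : d != 0 by apply: contraNneq mi => d0; rewrite eg d0 mulr0.
apply/rowP => j; apply: (mulIf d0); rewrite !mxE mul0r mulr_suml.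
rewrite -[RHS](sum_col_signed_minor f j rM); apply: eq_bigr => l _.
by rewrite mxE [signed_minor _ _]eg mulrA [g l 0 * _]mulrC.
Qed.

Lemma linear_form_mulmx (R : idomainType) (n : nat)
    (psi : {linear 'cV[R]_n -> R^o}) (v : 'cV[R]_n) :
  psi v = ((\row_i psi (delta_mx i 0)) *m v) 0 0.
Proof.
rewrite mxE {1}[v]matrix_sum_delta linear_sum; apply: eq_bigr => i _.
by rewrite big_ord1 linearZ mxE [RHS]mulrC.
Qed.

Theorem proposition1p6 (k : fieldType) (r : nat) (hr : (3 <= r)%N)
    (n m : nat) (hn : (0 < n)%N) (hnm : (n <= m)%N)
    (M : 'M[{mpoly k[r]}]_(n, m)) (hM : rank_dom M = n.-1)
    (gamma : 'cV[{mpoly k[r]}]_n) (hgamma : is_gamma M gamma) :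
  presentation_matrix M <->
  (forall v : 'cV[{mpoly k[r]}]_n, syzygy gamma v -> in_colspan M v).
Proof.
case: n hn hnm M hM gamma hgamma => // n _ hnm M hM gamma hgamma.
have gM : gamma^T *m M = 0 by apply: gamma_mulmx hgamma; rewrite hM.
split=> [[_ [psi psiP]] v /syzygyE gv | syzM].
  apply/in_colspanE/psiP; rewrite linear_form_mulmx.
  set p := \row_i _.
  suff pM : p *m M = 0.
    rewrite (left_kernel_common_zeros hM pM gM _ gv) ?mxE //.
    by rewrite trmx_eq0 (gamma_neq0 hgamma).
  apply/rowP => j.
  have /psiP : exists u : 'cV_m, col j M = M *m u.
    by exists (delta_mx j 0); rewrite colE.
  by rewrite linear_form_mulmx colE mulmxA -colE !mxE.
split=> //.
pose psi (v : 'cV[{mpoly k[r]}]_n.+1) : {mpoly k[r]}^o := (gamma^T *m v) 0 0.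
have psi_lin : linear psi.
  by move=> a u v; rewrite /psi mulmxDr -scalemxAr !mxE.
pose L := GRing.isLinear.Build _ _ _ _ psi psi_lin.
pose psiL : {linear 'cV[{mpoly k[r]}]_n.+1 -> {mpoly k[r]}^o} :=
  HB.pack psi L.
exists psiL => v; split=> [psi0 | [u ->]].
  apply/in_colspanE/syzM/syzygyE/matrixP => i j.
  by rewrite !ord1 [LHS]psi0 mxE.
by rewrite /= /psi mulmxA gM mul0mx mxE.
Qed.
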